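(* Let $n$ be a positive integer, let $A\in \mathrm{GL}_n(\mathbb{Z})$, and let $G=\mathbb{Z}^n\rtimes_A \mathbb{Z}$. Suppose that $G$ admits a strongly scale-invariant homomorphism $f:G\to G$. Then $G$ is virtually nilpotent.
   Context: For $A\in\mathrm{GL}_n(\mathbb{Z})$, the semi-direct product $\mathbb{Z}^n\rtimes_A\mathbb{Z}$ is the set $\mathbb{Z}^n\times\mathbb{Z}$ with group law $(v,z)(w,c)=(v+A^z w,\,z+c)$. A homomorphism $f:G\to G$ of a group $G$ is called strongly scale-invariant if $f$ is injective, $f(G)$ is a proper finite index subgroup of $G$, and $\bigcap_{k\ge 0} f^k(G)$ is finite, where $f^k$ denotes the $k$-th iterate of $f$. A group $H$ is nilpotent if its lower central series, defined by $\gamma_0(H)=H$ and $\gamma_k(H)=[\gamma_{k-1}(H),H]$ for $k>0$, is eventually trivial. A group is virtually nilpotent if it contains a nilpotent subgroup of finite index. *)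

(* Defs.v *)
From HB Require Import structures.
From mathcomp Require Import all_boot all_algebra.
From mathcomp Require Import boolp classical_sets functions cardinality.

Set Implicit Arguments.
Unset Strict Implicit.
Unset Printing Implicit Defensive.

Import GRing.Theory.
Local Open Scope group_scope.
Local Open Scope classical_set_scope.

Section Groups.
Variable G : groupType.
Implicit Types H K : set G.

Definition is_subgroup H : Prop :=
  [/\ H 1, forall x y, H x -> H y -> H (x * y) & forall x, H x -> H x^-1].

Definition left_cosets H : set (set G) :=
  [set [set x * h | h in H] | x in [set: G]].

Definition has_finite_index H : Prop := finite_set (left_cosets H).

Definition generated (S : set G) : set G := smallest is_subgroup S.

Definition commutator_subgroup H K : set G :=
  generated [set [~ x.1, x.2] | x in H `*` K].

Fixpoint lower_central H (k : nat) : set G :=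
  if k is k'.+1 then commutator_subgroup (lower_central H k') H else H.

Definition is_nilpotent H : Prop :=
  exists c : nat, forall k : nat, (c <= k)%N -> lower_central H k = [set 1].

Definition virtually_nilpotent : Prop :=
  exists H, [/\ is_subgroup H, has_finite_index H & is_nilpotent H].

Definition strongly_scale_invariant (f : {multiplicative G -> G}) : Prop :=
  [/\ injective f,
      [/\ is_subgroup (range f), range f <> [set: G] & has_finite_index (range f)]
    & finite_set (\bigcap_(k in [set: nat]) range (iter k f))].

End Groups.

Arguments virtually_nilpotent : clear implicits.

(* The type ignores the invertibility proof, which is only needed for the
   group laws: [exprz] is the two-sided power of [A] only when [A] is a unit. *)
Definition semidirect (n : nat) (A : 'M[int]_n.+1) (hA : A \in unitmx) : Type :=
  ('cV[int]_n.+1 * int)%type.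

Section Semidirect.
Variables (n : nat) (A : 'M[int]_n.+1) (hA : A \in unitmx).
Local Open Scope ring_scope.

Let T := semidirect hA.

HB.instance Definition _ := Choice.copy T ('cV[int]_n.+1 * int)%type.

Definition sd_mul (x y : T) : T := (x.1 + A ^ x.2 *m y.1, x.2 + y.2).
Definition sd_one : T := (0, 0).
Definition sd_inv (x : T) : T := (- (A ^ (- x.2) *m x.1), - x.2).

Lemma sd_mulA : associative sd_mul.
Proof.
move=> [u a] [v b] [w c]; rewrite /sd_mul /= exprzDr //.
by rewrite mulmxDr mulmxA !addrA.
Qed.

Lemma sd_mul1 : left_id sd_one sd_mul.
Proof. by move=> [v b]; rewrite /sd_mul /= expr0z mul1mx !add0r. Qed.

Lemma sd_mulr1 : right_id sd_one sd_mul.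
Proof. by move=> [v b]; rewrite /sd_mul /= mulmx0 !addr0. Qed.

Lemma sd_mulV : left_inverse sd_one sd_inv sd_mul.
Proof. by move=> [v b]; rewrite /sd_mul /= !addNr. Qed.

Lemma sd_mulrV : right_inverse sd_one sd_inv sd_mul.
Proof.
move=> [v b]; rewrite /sd_mul /= mulmxN mulmxA.
have -> : A ^ b *m A ^ (- b) = 1 by rewrite -[_ *m _]exprzDr // subrr expr0z.
by rewrite mul1mx !subrr.
Qed.

HB.instance Definition _ :=
  isGroup.Build T sd_mulA sd_mul1 sd_mulr1 sd_mulV sd_mulrV.

End Semidirect.

(* Main.v *)
(* If f preserves Z^n, it induces multiplication by some e on G / Z^n = Z. If
   instead f (u, 0) = (y, m) with m <> 0 for some u, then f(Z^n) is abelian and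
   normal in the finite index subgroup f(G), so (v, 0) with v in a finite index
   sublattice satisfies [[(v, 0), (y, m)], (y, m)] = 1; hence (A^m - 1)^2 = 0
   and G is virtually nilpotent. Otherwise replace f by f^2, so that e becomes
   the square a = e^2, and let B be the matrix of f^2 on Z^n; then B A = A^a B with
   det B <> 0.
   - If a > 1, the finite set of eigenvalues of A is stable under z |-> z^a, so
     these are all roots of unity and some power of A is unipotent.
   - If a = 0, then A = 1.
   - If a = 1, then f^2 has a nontrivial fixed point, contradicting the
     finiteness of the intersection of the f^k(G) as G is torsion free. If
     det (1 - B) = 0 the fixed point is in Z^n; otherwise, with t = (0, 1) and
     f^2 (t^k) = (s_k, k), some s_k with k > 0 is divisible by det (1 - B),
     and ((1 - B)^-1 s_k, k) is fixed. *)
Require Import Defs.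
From HB Require Import structures.
From mathcomp Require Import all_boot all_algebra all_field.
From mathcomp Require Import boolp classical_sets cardinality.

Set Implicit Arguments.
Unset Strict Implicit.
Unset Printing Implicit Defensive.

Import GRing.Theory Num.Theory.
Local Open Scope ring_scope.
Local Open Scope classical_set_scope.

(** * Pigeonhole arguments *)

Lemma finite_set_pigeonhole T (S : set T) (h : nat -> T) :
  finite_set S -> (forall i, S (h i)) -> exists i j, (i < j)%N /\ h i = h j.
Proof.
move=> finS hS; apply: contrapT => noij.
have h_inj : {in h @^-1` S &, injective h}.
  move=> i j _ _ eq_h; case: (ltngtP i j) => // ltij; exfalso; apply: noij.
    by exists i, j.
  by exists j, i.
have := finite_preimage h_inj finS.
rewrite (_ : h @^-1` S = [set: nat]); first exact: infinite_nat.
by apply/seteqP; split=> // i _; apply: hS.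
Qed.

(** Reducing the entries modulo [d] leaves only finitely many matrices. *)
Lemma modz_pigeonhole m n (d : int) (s : nat -> 'M[int]_(m, n)) : d != 0 ->
  exists i j (M : 'M[int]_(m, n)), (i < j)%N /\ s j = s i + d *: M.
Proof.
move=> d0.
have ltd (z : int) : (`|(z %% d)%Z|%N < `|d|.-1.+1)%N.
  rewrite prednK ?absz_gt0 //.
  by rewrite -ltz_nat abszE ger0_norm ?modz_ge0 // abszE ltz_mod.
pose h i := \matrix_(x, y) Ordinal (ltd (s i x y)).
have [|//|i [j [ltij eq_h]]] := @finite_set_pigeonhole _ setT h.
  exact: finite_finset.
exists i, j, (\matrix_(x, y) (divz (s j x y) d - divz (s i x y) d)); split=> //.
apply/matrixP=> x y; rewrite !mxE.
move/matrixP/(_ x y): eq_h; rewrite !mxE => /(congr1 val) /= /(congr1 Posz).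
rewrite !abszE !ger0_norm ?modz_ge0 //= => eq_mod.
by rewrite [LHS](divz_eq (s j x y) d) -eq_mod /modz addrCA -mulrBl mulrC.
Qed.

(** * Eigenvalues and unipotent powers *)

(** With [m] a common exponent of the eigenvalues, the characteristic polynomial divides a power of
    X^m - 1, and Cayley-Hamilton applies. *)
Lemma root_unity_unipotent n (A : 'M[algC]_n.+1) :
  (forall z, root (char_poly A) z -> exists2 m, (0 < m)%N & z ^+ m = 1) ->
  exists m k, (0 < m)%N /\ (A ^+ m - 1) ^+ k = 0.
Proof.
move=> unity.
have [s ps] := closed_field_poly_normal (char_poly A).
have {unity} unity_s : {in s, forall z, exists2 m, (0 < m)%N & z ^+ m = 1}.
  move=> z zs; apply: unity; rewrite ps rootZ ?root_prod_XsubC //.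
  by rewrite (monicP (char_poly_monic A)) oner_eq0.
have [m m_gt0 um] : exists2 m, (0 < m)%N & {in s, forall z, z ^+ m = 1}.
  elim: s unity_s {ps} => [|z s IHs] us; first by exists 1%N.
  have [|m m_gt0 um] := IHs; first by move=> y ys; apply: us; rewrite inE ys orbT.
  have [m' m'_gt0 zm'] := us z (mem_head _ _).
  exists (m * m')%N => [|y]; first by rewrite muln_gt0 m_gt0.
  rewrite inE => /predU1P[-> | ys]; first by rewrite mulnC exprM zm' expr1n.
  by rewrite exprM um // expr1n.
exists m, (size s); split=> //.
have dvd_p : char_poly A %| ('X^m - 1) ^+ size s.
  rewrite ps (monicP (char_poly_monic A)) scale1r.
  elim: s um {ps unity_s} => [|z s IHs] us; first by rewrite big_nil dvd1p.
  rewrite big_cons exprS dvdp_mul ?IHs // => [|y ys].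
    by rewrite dvdp_XsubCl /root !hornerE us ?mem_head ?subrr //.
  by apply: us; rewrite inE ys orbT.
have -> : (A ^+ m - 1) ^+ size s = horner_mx A (('X^m - 1) ^+ size s).
  by rewrite rmorphXn rmorphB rmorph1 /= rmorphXn /= horner_mx_X.
by case/dvdpP: dvd_p => q ->; rewrite rmorphM /= Cayley_Hamilton mulr0.
Qed.

(** If v is a row eigenvector of [A] for z, then v B is one for z^a. So z, z^a, z^(a^2), ... all lie
    in the finite spectrum, two of them agree, and z, being nonzero, is a root of unity. *)
Lemma expansive_conj_unipotent n (A B : 'M[int]_n.+1) (a : nat) :
    A \in unitmx -> \det B != 0 -> (1 < a)%N -> B * A = A ^+ a * B ->
  exists m k, (0 < m)%N /\ (A ^+ m - 1) ^+ k = 0.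
Proof.
move=> uA dB a_gt1 BA.
pose toC : {rmorphism int -> algC} := intr.
pose AC := map_mx toC A; pose BC := map_mx toC B.
have uAC : AC \in unitmx by rewrite unitmxE det_map_mx rmorph_unit.
have uBC : BC \in unitmx by rewrite unitmxE unitfE det_map_mx intr_eq0.
have BAC : BC *m AC = AC ^+ a *m BC.
  by rewrite -map_mxM /= -[_ *m _]/(B * A) BA map_mxM /= rmorphXn.
have eig_pow z : eigenvalue AC z -> eigenvalue AC (z ^+ a).
  case/eigenvalueP=> v vz v0; apply/eigenvalueP; exists (v *m BC).
    rewrite -mulmxA BAC mulmxA scalemxAl; congr (_ *m _).
    elim: (a) => [|i IHi]; first by rewrite mulmx1 scale1r.
    by rewrite exprSr mulmxA IHi -scalemxAl vz scalerA -exprSr.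
  apply: contraNneq v0 => v0; apply/eqP.
  by rewrite -(mulmxK uBC v) v0 mul0mx.
have [|m [k [m_gt0 eq0]]] := @root_unity_unipotent n AC.
  move=> z; rewrite -eigenvalue_root_char => eig_z.
  have z0 : z != 0.
    apply: contraTneq eig_z => ->; apply/eigenvalueP=> -[v].
    rewrite scale0r => v0; apply/negP; rewrite negbK; apply/eqP.
    by rewrite -(mulmxK uAC v) v0 mul0mx.
  have eig_i i : eigenvalue AC (z ^+ (a ^ i)).
    by elim: i => // i IHi; rewrite expnSr exprM eig_pow.
  have [s ps] := closed_field_poly_normal (char_poly AC).
  have [|i|i [j [ltij eqz]]] :=
    @finite_set_pigeonhole _ [set` s] (fun i => z ^+ (a ^ i)).
  - exact: finite_seq.
  - have := eig_i i; rewrite eigenvalue_root_char ps rootZ.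
      by rewrite root_prod_XsubC.
    by rewrite (monicP (char_poly_monic _)) oner_eq0.
  (* Here [1 < a] enters: it makes the two exponents distinct. *)
  have lt_a : (a ^ i < a ^ j)%N by rewrite ltn_exp2l.
  exists (a ^ j - a ^ i)%N; first by rewrite subn_gt0.
  apply: (mulIf (expf_neq0 (a ^ i) z0)).
  by rewrite -exprD subnK ?mul1r // ltnW.
have toC_inj : injective (map_mx toC : 'M_n.+1 -> 'M_n.+1).
  move=> M N /matrixP eqMN; apply/matrixP=> x y.
  by apply: (@intr_inj algC); have := eqMN x y; rewrite !mxE.
exists m, k; split=> //; apply: toC_inj.
by rewrite map_mx0 -eq0 rmorphXn rmorphB rmorph1 /= rmorphXn.
Qed.

(** * Cosets of finite index subgroups *)

Lemma left_coset_eqP (G : groupType) (H : set G) (x y : G) : is_subgroup H ->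
  [set (x * h)%g | h in H] = [set (y * h)%g | h in H] <-> H (x^-1 * y)%g.
Proof.
case=> H1 HM HV; split=> [eq_xy | Hxy].
  have : [set (y * h)%g | h in H] y by exists 1%g; rewrite ?mulg1.
  by rewrite -eq_xy => -[h Hh <-]; rewrite mulKg.
apply/seteqP; split=> _ [h Hh <-].
  exists ((x^-1 * y)^-1 * h)%g; first by apply: HM => //; apply: HV.
  by rewrite invgM invgK mulgA mulVKg.
exists (x^-1 * y * h)%g; first exact: HM.
by rewrite -mulgA mulVKg.
Qed.

(** Two of the cosets x^i H coincide. *)
Lemma finite_index_expg (G : groupType) (H : set G) (x : G) :
  is_subgroup H -> has_finite_index H -> exists2 k, (0 < k)%N & H (x ^+ k)%g.
Proof.
move=> sgH finH.
have [|i [j [ltij]]] := @finite_set_pigeonhole _ (left_cosets H)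
    (fun i => [set (x ^+ i * h)%g | h in H]) finH.
  by move=> i; exists (x ^+ i)%g.
move/(left_coset_eqP _ _ sgH); rewrite -(subnKC (ltnW ltij)) expgnDr mulKg.
by exists (j - i)%N; rewrite ?subn_gt0.
Qed.

Lemma generated_sub (G : groupType) (S H : set G) :
  is_subgroup H -> S `<=` H -> generated S `<=` H.
Proof. by move=> sgH sSH; apply: smallest_sub. Qed.

(** * Commutators in the semidirect product *)

Lemma sd_mulE n (A : 'M[int]_n.+1) (hA : A \in unitmx) (x y : semidirect hA) :
  (x * y)%g = (x.1 + A ^ x.2 *m y.1, x.2 + y.2).
Proof. by []. Qed.

Lemma sd_invE n (A : 'M[int]_n.+1) (hA : A \in unitmx) (x : semidirect hA) :
  (x^-1)%g = (- (A ^ (- x.2) *m x.1), - x.2).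
Proof. by []. Qed.

Lemma mulmx_exprzN n (A : 'M[int]_n.+1) (z : int) (v : 'cV[int]_n.+1) :
  A \in unitmx -> A ^ z *m (A ^ (- z) *m v) = v.
Proof.
move=> hA; rewrite mulmxA -[_ *m A ^ _]/(A ^ z * A ^ (- z)) -exprzDr //.
by rewrite subrr expr0z mul1mx.
Qed.

Lemma sd_commgE n (A : 'M[int]_n.+1) (hA : A \in unitmx) (x y : semidirect hA) :
  [~ x, y]%g = (A ^ (- (x.2 + y.2)) *m
                 ((A ^ x.2 - 1) *m y.1 - (A ^ y.2 - 1) *m x.1), 0).
Proof.
rewrite /commg /conjg mulgA -invgM !sd_mulE sd_invE /=.
rewrite [y.2 + _]addrC addNr; congr (_, _).
rewrite [LHS]addrC -mulmxBr; congr (_ *m _).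
rewrite !mulmxBl !mul1mx opprB opprD !addrA.
by congr (_ + _); rewrite [x.1 + _]addrC addrAC.
Qed.

(** * Virtual nilpotency from a unipotent power *)

(** A negative exponent reduces to a positive one by P^(-c) - 1 = -(P^c - 1) P^(-c), where P =
    A^m. *)
Lemma expr_dvd_exprz n (A : 'M[int]_n.+1) (m : nat) (b : int) : A \in unitmx ->
  exists V : 'M[int]_n.+1, A ^ (m%:Z * b) - 1 = (A ^+ m - 1) * V.
Proof.
move=> hA; rewrite -exprz_exp -exprnP; set P := A ^+ m.
have uP : P \is a GRing.unit by rewrite unitrX.
case: b => c; first by rewrite -exprnP subrX1; eexists.
rewrite NegzE -invr_expz -exprnP.
have [V eqV] : exists V, P ^+ c.+1 - 1 = (P - 1) * V.
  by rewrite subrX1; eexists.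
exists (- (V * P ^- c.+1)); rewrite mulrN mulrA -eqV mulrBl mul1r.
by rewrite divrr ?unitrX // opprB.
Qed.

(** The nilpotent subgroup [H] is the preimage of mZ. Each commutator with [H] contributes a factor
    U = A^m - 1, so for i > 0 the i-th term of its lower central series lies in U^i Z^n. *)
Lemma unipotent_virtually_nilpotent n (A : 'M[int]_n.+1) (hA : A \in unitmx)
    (m k : nat) :
  (0 < m)%N -> (A ^+ m - 1) ^+ k = 0 -> virtually_nilpotent (semidirect hA).
Proof.
set U := A ^+ m - 1 => m_gt0 U0.
pose H : set (semidirect hA) := [set x | exists b, x.2 = m%:Z * b].
pose L i : set (semidirect hA) := [set x | x.2 = 0 /\ exists w, x.1 = U ^+ i *m w].
have sgH : is_subgroup H.
  split=> [|x y [b xb] [c yc]|x [b xb]]; first by exists 0; rewrite mulr0.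
    by exists (b + c); rewrite sd_mulE /= xb yc mulrDr.
  by exists (- b); rewrite sd_invE /= xb mulrN.
have sgL i : is_subgroup (L i).
  split=> [|[v a] [w b] [/= -> [v' ->]] [/= -> [w' ->]]|[v a] [/= -> [v' ->]]].
  - by split=> //; exists 0; rewrite mulmx0.
  - by split=> //; exists (v' + w'); rewrite /= expr0z mul1mx mulmxDr.
  - by split=> //; exists (- v'); rewrite /= expr0z mul1mx mulmxN.
have commU i z : A ^ z *m U ^+ i = U ^+ i *m A ^ z.
  apply/commr_sym/commrXz/commr_sym/commrX; apply: commrB; last exact: commr1.
  exact: commrX.
have lcL i : lower_central H i.+1 `<=` L i.+1.
  elim: i => [|i IHi]; apply: generated_sub => // _ [[x y] [/= Hx Hy] <-].
    rewrite sd_commgE; split=> //; case: Hx Hy => b -> [c ->] /=.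
    have [V ->] := expr_dvd_exprz m b hA; have [W ->] := expr_dvd_exprz m c hA.
    eexists; rewrite -!mulmxA -mulmxBr -/U -[U in U *m (_ - _)]expr1.
    by rewrite mulmxA commU -mulmxA.
  have [x0 [w xw]] := IHi _ Hx; have [b yb] := Hy.
  rewrite sd_commgE; split=> //; rewrite x0 expr0z subrr mul0mx !add0r /= yb xw.
  have [V eV] := expr_dvd_exprz m b hA.
  rewrite mulmxBl mul1mx mulmxA commU -mulmxA -mulmxBr.
  rewrite -[w in X in _ - X]mul1mx -mulmxBl eV -/U.
  rewrite -mulmxA mulmxA -[U ^+ _ *m U]exprSr -mulmxN mulmxA commU -mulmxA.
  by eexists.
exists H; split=> //.
  (* Since Z^n lies in [H], the elements (0, i) with i < m represent all left cosets. *)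
  pose coset (i : 'I_m) := [set ((0, i%:Z) : semidirect hA) * h | h in H]%g.
  apply: (@sub_finite_set _ _ (coset @` setT)).
    move=> _ [x _ <-].
    have m0 : m%:Z != 0 by case: (m) m_gt0.
    have abs_mod : `|(x.2 %% m)%Z|%N = (x.2 %% m)%Z :> int.
      by rewrite abszE ger0_norm ?modz_ge0.
    have ltm : (`|(x.2 %% m)%Z|%N < m)%N by rewrite -ltz_nat abs_mod ltz_pmod.
    exists (Ordinal ltm) => //; apply/left_coset_eqP => //.
    exists (x.2 %/ m)%Z; rewrite sd_mulE sd_invE /= abs_mod.
    by rewrite {2}(divz_eq x.2 m) addrCA addNr addr0 mulrC.
  exact: finite_image finite_finset.
(* The bound [k.+1] rather than [k] rules out index 0, about which [lcL] says nothing. *)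
exists k.+1 => -[|i]; rewrite // ltnS => leki.
apply/seteqP; split=> [x /lcL [x0 [w]] | _ ->].
  rewrite -(subnK (leqW leki)) exprD U0 mulr0 mul0mx => x1.
  by case: x x0 x1 => /= ? ? -> ->.
by move=> S [[]].
Qed.

(** * Integer matrices and additive maps *)

Lemma mulmx_ext m n (M N : 'M[int]_(m, n)) :
  (forall u : 'cV_n, M *m u = N *m u) -> M = N.
Proof.
move=> eqMN; apply/matrixP=> i j.
by have /matrixP/(_ i 0) := eqMN (delta_mx j 0); rewrite -!colE !mxE.
Qed.

Lemma mulrn_mx_eq0 m n (M : 'M[int]_(m, n)) k : (0 < k)%N -> M *+ k = 0 -> M = 0.
Proof.
rewrite lt0n => /negPf k0 /matrixP Mk; apply/matrixP=> i j; have /eqP := Mk i j.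
by rewrite mulmxnE !mxE mulrn_eq0 k0 /= => /eqP.
Qed.

Lemma additive_mulmx m n (phi : {additive 'cV[int]_n -> 'cV[int]_m}) :
  exists B : 'M_(m, n), forall u, phi u = B *m u.
Proof.
exists (\matrix_(i, j) phi (delta_mx j 0) i 0) => u.
rewrite [u in LHS]matrix_sum_delta raddf_sum; apply/matrixP=> i j.
rewrite ord1 summxE mxE; apply: eq_bigr => l _.
by rewrite big_ord1 -[u l 0 in LHS]intz scaler_int raddfMz -scaler_int intz !mxE mulrC.
Qed.

Lemma det0_col n (M : 'M[int]_n) :
  \det M = 0 -> exists2 v : 'cV_n, v != 0 & M *m v = 0.
Proof.
rewrite -det_tr => /eqP/det0P[v v0 vM]; exists v^T; first by rewrite trmx_eq0.
by apply: trmx_inj; rewrite trmx_mul trmxK vM trmx0.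
Qed.

(** * Powers and torsion in the semidirect product *)

Lemma sd_split n (A : 'M[int]_n.+1) (hA : A \in unitmx) (v : 'cV_n.+1) (z : int) :
  (v, z) = (((v, 0) : semidirect hA) * ((0, z) : semidirect hA))%g.
Proof. by rewrite sd_mulE /= mulmx0 addr0 add0r. Qed.

Lemma sd_snd_expg n (A : 'M[int]_n.+1) (hA : A \in unitmx) (x : semidirect hA) i :
  (x ^+ i)%g.2 = x.2 *+ i.
Proof. by elim: i => // i IHi; rewrite expgS sd_mulE /= IHi mulrS. Qed.

Lemma sd_expg_fst n (A : 'M[int]_n.+1) (hA : A \in unitmx) (v : 'cV_n.+1) i :
  (((v, 0) : semidirect hA) ^+ i)%g = (v *+ i, 0).
Proof.
by elim: i => // i IHi; rewrite expgS IHi sd_mulE /= expr0z mul1mx mulrS addr0.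
Qed.

Lemma sd_expg_snd n (A : 'M[int]_n.+1) (hA : A \in unitmx) i :
  (((0, 1)%R : semidirect hA) ^+ i)%g = (0, i%:Z).
Proof. by elim: i => // i IHi; rewrite expgS IHi sd_mulE /= mulmx0 addr0 -intS. Qed.

Lemma sd_torsion_free n (A : 'M[int]_n.+1) (hA : A \in unitmx)
    (x : semidirect hA) k : (0 < k)%N -> (x ^+ k)%g = 1%g -> x = 1%g.
Proof.
case: x => v z; rewrite lt0n => k0 xk.
have := congr1 snd xk; rewrite sd_snd_expg /= => /eqP.
rewrite mulrn_eq0 (negPf k0) /= => /eqP z0.
by move: xk; rewrite z0 sd_expg_fst => -[] /mulrn_mx_eq0->; rewrite ?lt0n.
Qed.

(** * Endomorphisms of the semidirect product *)

(** For every v some (k v, 0) with k > 0 is an image f(q). As [q, (u, 0)] lies in the abelian group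
    Z^n, it commutes with (u, 0); applying [f] to this relation gives (A^m - 1)^2 k v = 0 up to
    powers of [A]. *)
Lemma sd_fst_commg_unipotent n (A : 'M[int]_n.+1) (hA : A \in unitmx)
    (f : UMagmaMorphism.type (semidirect hA) (semidirect hA)) (u : 'cV_n.+1) (m : nat) :
    is_subgroup (range f) -> has_finite_index (range f) ->
    (f (u, 0)).2 = m -> (A ^+ m - 1) ^+ 2 = 0.
Proof.
move=> sgf finf fu; apply: mulmx_ext => v; rewrite mul0mx.
have [k k_gt0 [q _]] := finite_index_expg ((v, 0) : semidirect hA) sgf finf.
rewrite sd_expg_fst => fq.
have : [~ [~ q, ((u, 0) : semidirect hA)], ((u, 0) : semidirect hA)]%g = 1%g.
  by rewrite sd_commgE sd_commgE /= !expr0z subrr !mul0mx subrr mulmx0.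
move/(congr1 f); rewrite gmulf1 !gmulfR fq; set x := f (u, 0) in fu *.
rewrite [in LHS]sd_commgE sd_commgE fu /= !expr0z !add0r subrr !mul0mx !add0r.
move/(congr1 fst) => /=; rewrite -exprnP; set U := A ^+ m - 1.
have commU : U *m A ^ (- m%:Z) = A ^ (- m%:Z) *m U.
  by apply/commrXz/commr_sym/commrB; [exact: commrX | exact: commr1].
rewrite !mulmxN opprK [U *m (A ^ _ *m _)]mulmxA commU -mulmxA.
(* Each of the two commutators left a factor A^(-m) to cancel. *)
move/(congr1 (mulmx (A ^ m))); rewrite mulmx_exprzN // mulmx0.
move/(congr1 (mulmx (A ^ m))); rewrite mulmx_exprzN // mulmx0.
by rewrite mulmxA raddfMn /=; apply: mulrn_mx_eq0.
Qed.

(** With g(t^k) = (s_k, k), the point (w, k) is fixed exactly when (1 - B) w = s_k. *)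
Lemma sd_twisted_fixed_point n (A : 'M[int]_n.+1) (hA : A \in unitmx)
    (g : UMagmaMorphism.type (semidirect hA) (semidirect hA)) (B : 'M[int]_n.+1) :
    (forall u, g (u, 0) = (B *m u, 0)) -> (g (0, 1)).2 = 1 ->
  exists2 x, x <> 1%g & g x = x.
Proof.
move=> gB gt.
have [d0 | d0] := eqVneq (\det (1 - B)) 0.
  have [v v0] := det0_col d0; rewrite mulmxBl mul1mx => /eqP.
  rewrite subr_eq0 => /eqP Bv.
  exists (v, 0); last by rewrite gB -Bv.
  by case=> /eqP; rewrite (negPf v0).
pose t : semidirect hA := (0, 1).
pose s i := (g (t ^+ i)%g).1.
have gti i : g (t ^+ i)%g = (s i, i%:Z).
  rewrite [LHS]surjective_pairing; congr (_, _).
  by rewrite gmulfXn sd_snd_expg gt -[RHS]natz.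
have [i [j [M [ltij]]]] := modz_pigeonhole s d0.
have j_def : (j = i + (j - i))%N by rewrite subnKC // ltnW.
have k_gt0 : (0 < j - i)%N by rewrite subn_gt0.
move: (j - i)%N k_gt0 j_def => k k_gt0 -> {j ltij}.
(* The cocycle identity s_(i+k) = s_i + A^i s_k yields A^i s_k = det (1 - B) M. *)
rewrite {1}/s expgnDr gmulfM !gti sd_mulE /= => /addrI eqM.
(* As s_k is divisible by the determinant, the adjugate provides an integral solution w. *)
have sk : s k = (1 - B) *m (\adj (1 - B) *m (A ^ (- i%:Z) *m M)).
  rewrite mulmxA mul_mx_adj mul_scalar_mx scalemxAr -eqM mulmxA.
  by rewrite -[_ *m A ^ _]/(A ^ _ * A ^ _) -exprzDr // addNr expr0z mul1mx.
exists (\adj (1 - B) *m (A ^ (- i%:Z) *m M), k%:Z).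
  by case=> _ k0; rewrite k0 in k_gt0.
rewrite (sd_split hA) gmulfM gB -(sd_expg_snd hA) gti sk sd_mulE sd_expg_snd sd_mulE /=.
by rewrite expr0z !mul1mx mulmxBl mul1mx addr0 addrC subrK.
Qed.

(** Each power x^i equals f^k(f^k(x^i)), hence lies in every f^k(G). By finiteness two powers agree,
    and the group is torsion free. *)
Lemma scale_invariant_fixed_point n (A : 'M[int]_n.+1) (hA : A \in unitmx)
    (f : UMagmaMorphism.type (semidirect hA) (semidirect hA)) x :
  strongly_scale_invariant f -> f (f x) = x -> x = 1%g.
Proof.
move=> [_ _ fin_f] ffx.
have [|i [j [ltij]]] := finite_set_pigeonhole (h := fun i => (x ^+ i)%g) fin_f.
  move=> i k _; exists (iter k f (x ^+ i)%g) => //.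
  rewrite -iterD addnn; elim: k => // k IHk.
  by rewrite doubleS 2!iterSr !gmulfXn ffx.
rewrite -(subnKC (ltnW ltij)) expgnDr -[LHS]mulg1 => /mulgI/esym.
by apply: sd_torsion_free; rewrite subn_gt0.
Qed.

Lemma sd_fst_mulmx n (A : 'M[int]_n.+1) (hA : A \in unitmx)
    (g : UMagmaMorphism.type (semidirect hA) (semidirect hA)) :
    (forall u, (g (u, 0)).2 = 0) ->
  exists B : 'M[int]_n.+1, forall u, g (u, 0) = (B *m u, 0).
Proof.
move=> g0; pose phi u := (g (u, 0)).1.
have g_phi u : g (u, 0) = (phi u, 0).
  by rewrite [LHS]surjective_pairing g0.
have phiD : {morph phi : u v / u + v}.
  move=> u v; have := @gmulfM _ _ g (u, 0) (v, 0).
  by rewrite sd_mulE /= expr0z mul1mx addr0 !g_phi sd_mulE /= expr0z mul1mx => -[].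
have phiB : zmod_morphism phi.
  by move=> u v; apply: (addIr (phi v)); rewrite -phiD !subrK.
pose Phi : {additive 'cV[int]_n.+1 -> 'cV[int]_n.+1} :=
  HB.pack phi (GRing.isZmodMorphism.Build _ _ phi phiB).
have [B phiE] := additive_mulmx Phi.
by exists B => u; rewrite g_phi -phiE.
Qed.

(** Apply [g] to (0, 1) (u, 0) = (A u, 0) (0, 1) and cancel the first component of g(0, 1). *)
Lemma sd_twist n (A : 'M[int]_n.+1) (hA : A \in unitmx)
    (g : UMagmaMorphism.type (semidirect hA) (semidirect hA)) (B : 'M[int]_n.+1) :
    (forall u, g (u, 0) = (B *m u, 0)) ->
  B * A = A ^ (g (0, 1)).2 * B.
Proof.
move=> gB; apply: mulmx_ext => u.
have : (((0, 1)%R : semidirect hA) * (u, 0) =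
        ((A *m u, 0)%R : semidirect hA) * (0, 1)%R)%g.
  by rewrite !sd_mulE /= mulmx0 !addr0 !add0r.
move/(congr1 g); rewrite !gmulfM !gB !sd_mulE /= => -[] + _.
rewrite expr0z mul1mx addrC => /addIr eqBA.
by rewrite -[B * A]/(B *m A) -[_ * B]/(_ *m B) -!mulmxA eqBA.
Qed.

(** * Case distinction on the image of Z^n and the induced multiplier *)

Theorem theorem1p2 (n : nat) (A : 'M[int]_n.+1) (hA : A \in unitmx)
    (f : {multiplicative semidirect hA -> semidirect hA})
    (hf : strongly_scale_invariant f) :
  virtually_nilpotent (semidirect hA).
Proof.
have f1 : f 1%g = 1%g by apply: (mulgI (f 1%g)); rewrite -gmulfM !mulg1.
pose F : UMagmaMorphism.type (semidirect hA) (semidirect hA) :=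
  HB.pack (f : _ -> _) (isUMagmaMorphism.Build _ _ f (f1, @gmulfM _ _ f)).
have {hf} : strongly_scale_invariant F by exact: hf.
move: F => F hF {f f1}.
have [F_inj [sgF _ finF] _] := hF.
have [F0 | /existsNP[u Fu]] := pselect (forall u, (F (u, 0)).2 = 0); last first.
  (* If the second component is negative, passing to -u makes it positive. *)
  have [m m_gt0 [w Fw]] : exists2 m, (0 < m)%N & exists w, (F (w, 0)).2 = m%:Z.
    case def_z: (F (u, 0)).2 => [m | m].
      by exists m; [case: m def_z Fu => [->|] | exists u].
    exists m.+1 => //; exists (- u).
    have -> : (- u, 0) = (((u, 0)%R : semidirect hA)^-1)%g.
      by rewrite sd_invE /= expr0z mul1mx oppr0.
    by rewrite gmulfV sd_invE /= def_z.
  apply: (unipotent_virtually_nilpotent hA m_gt0).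
  exact: sd_fst_commg_unipotent sgF finF Fw.
have Fsnd z : (F (0, z)).2 = z * (F (0, 1)).2.
  have Fnat i : (F (0, i%:Z)).2 = i%:Z * (F (0, 1)).2.
    by rewrite -(sd_expg_snd hA) gmulfXn sd_snd_expg -mulr_natl natz.
  case: z => i; first exact: Fnat.
  have -> : (0, Negz i) = (((0, i.+1%:Z)%R : semidirect hA)^-1)%g.
    by rewrite sd_invE /= mulmx0 oppr0.
  by rewrite gmulfV sd_invE /= Fnat NegzE mulNr.
(* Squaring makes the multiplier a natural number and absorbs the case e = -1 into a = 1. *)
pose g : UMagmaMorphism.type (semidirect hA) (semidirect hA) := (F \o F).
have g1 : (g (0, 1)).2 = (`|(F (0, 1)%R).2| ^ 2)%N.
  rewrite /= [F (0, 1)]surjective_pairing (sd_split hA) gmulfM sd_mulE /= F0 !add0r.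
  by rewrite Fsnd PoszM abszE -normrM -expr2 ger0_norm ?sqr_ge0.
have [|B gB] := @sd_fst_mulmx _ _ hA g.
  by move=> u; rewrite /= [F (u, 0)]surjective_pairing F0 F0.
have g_inj : injective g by apply: inj_comp.
(* The injective [g] would send a kernel vector of [B] to 1. *)
have dB : \det B != 0.
  apply/eqP => /det0_col[v v0 Bv]; have := gB v.
  rewrite Bv -[(0, 0)](@gmulf1 _ _ g) => /g_inj[] /eqP.
  by rewrite (negPf v0).
have := sd_twist gB; rewrite g1 -exprnP; move: (_ ^ 2)%N g1 => a g1 BA.
have [a_gt1 | ] := ltnP 1 a.
  have [m [k [m_gt0 Uk]]] := expansive_conj_unipotent hA dB a_gt1 BA.
  exact: unipotent_virtually_nilpotent m_gt0 Uk.
case: a => [|[|//]] in g1 BA *; move=> _; last first.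
  (* Case a = 1. *)
  have [x x1 gx] := sd_twisted_fixed_point gB g1.
  by case: x1; apply: scale_invariant_fixed_point hF gx.
(* Case a = 0: here B A = B, and the adjugate cancels [B]. *)
have A1 : A = 1.
  apply/eqP; rewrite -subr_eq0; apply/eqP.
  have : \adj B *m (B *m (A - 1)) = 0.
    by rewrite mulmxBr mulmx1 -[B *m A]/(B * A) BA mul1r subrr mulmx0.
  rewrite mulmxA mul_adj_mx mul_scalar_mx => /eqP.
  by rewrite scalemx_eq0 (negPf dB) => /eqP.
apply: (@unipotent_virtually_nilpotent _ _ hA 1 1) => //.
by rewrite !expr1 A1 subrr.
Qed.
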